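(* Let $R$ be a semilocal ring with $C=\mathrm{Cent}(R)$, put $\overline{R}=R/\mathrm{Jac}(R)$ and $\overline{C}=\mathrm{Cent}(\overline{R})$, and let $n\ge1$. Suppose that $\mathrm{M}_n(R)$ has an involution of type $\sigma\in\mathrm{Aut}(C)$ and reduced type $\overline{\sigma}\in\mathrm{Aut}(\overline{C})$. Write $\overline{R}\cong\prod_{i=1}^t\mathrm{M}_{n_i}(D_i)$ where each $D_i$ is a division ring and $n_i\in\mathbb{N}$, and identify $\overline{C}$ with $\prod_{i=1}^tF_i$ where $F_i=\mathrm{Cent}(D_i)$; view each $F_i$ as a non-unital subring of $\overline{C}$. Assume that there is $1\le\ell\le t$ such that for all $i\in\{1,\dots,t\}\setminus\{\ell\}$: (1) $D_i$ is not a field, or $n_i$ is even, or $\overline{\sigma}|_{F_i}\ne\mathrm{id}_{F_i}$; and for the index $\ell$: (2) $D_\ell$ is not a field, or $n_\ell$ is even, or $\overline{\sigma}|_{F_\ell}\neq\mathrm{id}_{F_\ell}$, or $2\in D_\ell^\times$. Then $R$ has an involution of type $\sigma$ and reduced type $\overline{\sigma}$.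
   Context: Rings are unital; $\mathrm{Jac}(R)$ is the Jacobson radical, $\mathrm{Cent}(R)$ the center, $D^\times$ the group of invertible elements. $R$ is semilocal if $R/\mathrm{Jac}(R)$ is semisimple artinian. An involution is an anti-automorphism $\alpha$ with $\alpha\circ\alpha=\mathrm{id}$. The centers of $\mathrm{M}_n(R)$ and of $\mathrm{M}_n(R)/\mathrm{Jac}(\mathrm{M}_n(R))=\mathrm{M}_n(\overline{R})$ are identified with $C$ and $\overline{C}$ respectively via scalar matrices. The type of an anti-automorphism of $R$ or $\mathrm{M}_n(R)$ is the automorphism of $C$ it induces by restriction to the center. Its reduced type is the automorphism of $\overline{C}$ that it induces on the center of the quotient of the ring by its Jacobson radical. ($\overline{C}$ may be larger than the image of $C$ in $\overline{R}$.) The condition $\overline{\sigma}|_{F_i}\ne\mathrm{id}_{F_i}$ means that $\overline{\sigma}$ does not fix $F_i$ pointwise. *)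

(* Defs.v *)
From HB Require Import structures.
From mathcomp Require Import all_boot all_order all_algebra.
From mathcomp Require Import generic_quotient ring_quotient.
From mathcomp Require Import boolp classical_sets.

Set Implicit Arguments.
Unset Strict Implicit.
Unset Printing Implicit Defensive.

Import GRing.Theory.
Local Open Scope ring_scope.
Local Open Scope quotient_scope.
Local Open Scope classical_set_scope.

Section Center.
Variable R : pzRingType.

Definition central : {pred R} := fun x => `[< forall y : R, x * y = y * x >].

Lemma centralP (x : R) : reflect (forall y, x * y = y * x) (x \in central).
Proof. exact: asboolP. Qed.

Fact central_subring_closed : subring_closed central.
Proof.
split=> [|x y /centralP cx /centralP cy|x y /centralP cx /centralP cy].
- by apply/centralP => z; rewrite mul1r mulr1.
- by apply/centralP => z; rewrite mulrBl mulrBr cx cy.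
- by apply/centralP => z; rewrite -mulrA cy mulrA cx mulrA.
Qed.
HB.instance Definition _ := GRing.isSubringClosed.Build R central
  central_subring_closed.

Definition Cent := {x : R | x \in central}.

HB.instance Definition _ := Choice.on Cent.
HB.instance Definition _ := [isSub of Cent for @sval _ _].
HB.instance Definition _ := GRing.SubChoice_isSubPzRing.Build R central Cent (subringClosedP _).

Fact Cent_mulC : commutative (@GRing.mul Cent).
Proof. by move=> x y; apply: val_inj; exact: (centralP _ (valP x)). Qed.
HB.instance Definition _ := GRing.PzRing_hasCommutativeMul.Build Cent Cent_mulC.

End Center.

Section LeftIdeals.
Variable R : pzRingType.
Implicit Types I J : set R.

Definition left_ideal I : Prop :=
  [/\ I 0, forall x y, I x -> I y -> I (x + y) & forall a x, I x -> I (a * x)].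

Definition maximal_left_ideal I : Prop :=
  [/\ left_ideal I, I <> setT &
      forall J, left_ideal J -> I `<=` J -> J <> setT -> J = I].

Definition semisimple_ring : Prop :=
  forall I, left_ideal I -> exists J,
    [/\ left_ideal J, I `&` J = [set 0] &
        forall x, exists y z, [/\ I y, J z & x = y + z]].

Definition artinian_ring : Prop :=
  forall I : nat -> set R, (forall k, left_ideal (I k)) ->
    (forall k, I k.+1 `<=` I k) ->
    exists N, forall k, (N <= k)%N -> I k = I N.

Definition jac : {pred R} :=
  fun x => `[< forall M, maximal_left_ideal M -> M x >].

Lemma jacP (x : R) :
  reflect (forall M, maximal_left_ideal M -> M x) (x \in jac).
Proof. exact: asboolP. Qed.

Lemma jac_mull (a x : R) : x \in jac -> a * x \in jac.
Proof.
move=> /jacP jx; apply/jacP => M mM; have Mx := jx _ mM.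
by case: mM => -[_ _ MM] _ _; apply: MM.
Qed.

Fact jac_zmod_closed : zmod_closed jac.
Proof.
split=> [|x y jx jy].
  by apply/jacP => M [[]].
move: (jac_mull (-1) jy) jx => /jacP jy' /jacP jx.
apply/jacP => M mM; move: (jx _ mM) (jy' _ mM); rewrite mulN1r.
by case: mM => -[_ MD _] _ _; apply: MD.
Qed.
HB.instance Definition _ := GRing.isZmodClosed.Build R jac jac_zmod_closed.

(* If M is maximal and r is not in M, then the transporter {x | x r in M} is
   again a maximal left ideal, so the intersection is two-sided. *)
Lemma jac_mulr (a x : R) : x \in jac -> x * a \in jac.
Proof.
move=> /jacP jx; apply/jacP => M mM.
have [Ma|nMa] := pselect (M a).
  by case: mM => -[_ _ MM] _ _; apply: MM.
suff mT : maximal_left_ideal [set y | M (y * a)] by exact: (jx _ mT).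
case: mM => -[M0 MD MM] MT Mmax; split.
- split=> /= [|y z|b y]; rewrite ?mul0r ?mulrDl -?mulrA //.
    exact: MD.
  exact: MM.
- by move=> eT; apply: nMa; have : setT (1 : R) by []; rewrite -eT /= mul1r.
move=> J [J0 JD JM] sJ JT; apply/seteqP; split=> // y Jy /=.
apply: contrapT => nMy; apply: JT; apply/seteqP; split=> // z _.
(* M + R (y a) = R *)
pose K := [set w | exists m b, M m /\ w = m + b * (y * a)].
have KT : K = setT.
  apply: contrapT => nKT; apply: nMy.
  have <- : K = M.
    apply: Mmax => //; first split.
    + by exists 0, 0; rewrite mul0r addr0.
    + move=> u v [m [b [Mm ->]]] [m' [b' [Mm' ->]]].
      exists (m + m'), (b + b'); split; first exact: MD.
      by rewrite mulrDl addrACA.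
    + move=> c u [m [b [Mm ->]]]; exists (c * m), (c * b).
      by split; [exact: MM | rewrite mulrDr mulrA].
    + by move=> m Mm; exists m, 0; rewrite mul0r addr0.
  by exists 0, 1; rewrite add0r mul1r.
have : K (z * a) by rewrite KT.
move=> [m [b [Mm e]]].
have -> : z = (z - b * y) + b * y by rewrite subrK.
apply: JD; last exact: JM.
by apply: sJ; rewrite /= mulrBl e -mulrA addrK.
Qed.

Definition JacQuot := {ideal_quot jac}.

HB.instance Definition _ := GRing.Zmodule.on JacQuot.

Definition jac_proj (x : R) : JacQuot := \pi_({ideal_quot jac}) x.

Lemma jac_proj_eq (x y : R) : (jac_proj x = jac_proj y) <-> (x - y \in jac).
Proof. by rewrite Quotient.idealrBE; split=> [e|/eqP e]; [apply/eqP|]. Qed.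

Lemma jac_proj_surj (u : JacQuot) : exists x, jac_proj x = u.
Proof. by exists (repr u); rewrite /jac_proj reprK. Qed.

Lemma jac_projB : zmod_morphism jac_proj.
Proof. by move=> x y; rewrite /jac_proj raddfB. Qed.
HB.instance Definition _ := GRing.isZmodMorphism.Build R JacQuot jac_proj
  jac_projB.

Definition jac_quot_mul (u v : JacQuot) : JacQuot := jac_proj (repr u * repr v).

Lemma jac_proj_mul (x y : R) :
  jac_quot_mul (jac_proj x) (jac_proj y) = jac_proj (x * y).
Proof.
have e z : repr (jac_proj z) - z \in jac.
  by apply/jac_proj_eq; exact: reprK.
apply/jac_proj_eq; set x' := repr _; set y' := repr _.
have -> : x' * y' - x * y = (x' - x) * y' + x * (y' - y).
  by rewrite mulrBl mulrBr addrA subrK.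
by apply: rpredD; [apply: jac_mulr; apply: e | apply: jac_mull; apply: e].
Qed.

Fact jac_quot_mulA : associative jac_quot_mul.
Proof.
move=> u v w; have [x <-] := jac_proj_surj u.
have [y <-] := jac_proj_surj v; have [z <-] := jac_proj_surj w.
by rewrite !jac_proj_mul mulrA.
Qed.

Fact jac_quot_mul1 : left_id (jac_proj 1) jac_quot_mul.
Proof. by move=> u; have [x <-] := jac_proj_surj u; rewrite jac_proj_mul mul1r. Qed.

Fact jac_quot_mulr1 : right_id (jac_proj 1) jac_quot_mul.
Proof. by move=> u; have [x <-] := jac_proj_surj u; rewrite jac_proj_mul mulr1. Qed.

Fact jac_quot_mulDl : left_distributive jac_quot_mul +%R.
Proof.
move=> u v w; have [x <-] := jac_proj_surj u.
have [y <-] := jac_proj_surj v; have [z <-] := jac_proj_surj w.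
by rewrite -raddfD !jac_proj_mul mulrDl raddfD.
Qed.

Fact jac_quot_mulDr : right_distributive jac_quot_mul +%R.
Proof.
move=> u v w; have [x <-] := jac_proj_surj u.
have [y <-] := jac_proj_surj v; have [z <-] := jac_proj_surj w.
by rewrite -raddfD !jac_proj_mul mulrDr raddfD.
Qed.

HB.instance Definition _ := GRing.Zmodule_isPzRing.Build JacQuot
  jac_quot_mulA jac_quot_mul1 jac_quot_mulr1 jac_quot_mulDl jac_quot_mulDr.

Fact jac_proj_monoid : monoid_morphism jac_proj.
Proof. by split=> // x y; rewrite -jac_proj_mul. Qed.
HB.instance Definition _ := GRing.isMonoidMorphism.Build R JacQuot jac_proj
  jac_proj_monoid.

End LeftIdeals.

Definition semilocal (R : pzRingType) : Prop :=
  semisimple_ring (JacQuot R) /\ artinian_ring (JacQuot R).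

Definition division_ring (D : unitRingType) : Prop :=
  forall x : D, x != 0 -> x \is a GRing.unit.

Section Involutions.

Definition anti_automorphism (R : pzRingType) (alpha : R -> R) : Prop :=
  [/\ bijective alpha, zmod_morphism alpha
    & monoid_morphism (alpha : R -> R^c)].

Definition involution (R : pzRingType) (alpha : R -> R) : Prop :=
  anti_automorphism alpha /\ involutive alpha.

Definition has_type (R : pzRingType) (alpha : R -> R)
    (sigma : Cent R -> Cent R) : Prop :=
  forall c : Cent R, alpha (val c) = val (sigma c).

Definition has_reduced_type (R : pzRingType) (alpha : R -> R)
    (sbar : Cent (JacQuot R) -> Cent (JacQuot R)) : Prop :=
  forall (c : Cent (JacQuot R)) (r : R),
    jac_proj r = val c -> jac_proj (alpha r) = val (sbar c).

(* For anti-automorphisms of M_n(R) the centers of M_n(R) and of its quotient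
   by the Jacobson radical are identified with those of R and R/Jac(R) through
   scalar matrices: c corresponds to c I, and the class of r, when central, to
   the class of r I. *)
Definition mx_has_type (R : pzRingType) (n : nat) (alpha : 'M[R]_n -> 'M[R]_n)
    (sigma : Cent R -> Cent R) : Prop :=
  forall c : Cent R, alpha (val c)%:M = (val (sigma c))%:M.

Definition mx_has_reduced_type (R : pzRingType) (n : nat)
    (alpha : 'M[R]_n -> 'M[R]_n)
    (sbar : Cent (JacQuot R) -> Cent (JacQuot R)) : Prop :=
  forall (c : Cent (JacQuot R)) (r s : R),
    jac_proj r = val c -> jac_proj s = val (sbar c) ->
    jac_proj (alpha r%:M) = jac_proj (s%:M : 'M[R]_n).

End Involutions.

Section Decomposition.
Variables (S : pzRingType) (t : nat) (D : 'I_t -> unitRingType) (m : 'I_t -> nat).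
Variable phi : forall i, {rmorphism S -> 'M[D i]_(m i)}.

(* The phi i are the components of a ring isomorphism from S to the product of
   the matrix rings. *)
Definition product_iso : Prop :=
  bijective (fun (x : S) (i : 'I_t) => phi i x).

(* Cent (D i) as a non-unital subring of Cent S: it consists of the central
   elements whose i-th component is a central scalar and whose other
   components vanish. *)
Definition center_factor (i : 'I_t) (c : Cent S) : Prop :=
  (exists a : Cent (D i), phi i (val c) = (val a)%:M) /\
  (forall j, j != i -> phi j (val c) = 0).

Definition fixes_factor (tau : Cent S -> Cent S) (i : 'I_t) : Prop :=
  forall c, center_factor i c -> tau c = c.

End Decomposition.

(* Main.v *)
Require Import Defs.
From mathcomp Require Import all_boot all_order all_algebra.
From mathcomp Require Import boolp classical_sets zify.

Set Implicit Arguments.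
Unset Strict Implicit.
Unset Printing Implicit Defensive.

Import GRing.Theory.
Local Open Scope ring_scope.

(** Let [S = M_n(R)] with involution [alpha], [e = e_11], and
    [K = alpha(e) S e].  If [k] in [K] is invertible, with [z k = e] and
    [k z = alpha(e)], and [alpha(k) = s k] with [s = 1] or [s = -1], then
    [r |-> z alpha(r) k] is an involution of [e S e = R] of the same type and
    reduced type as [alpha].  Elements of the form [u + s alpha(u)] are
    [s]-symmetric and can be lifted modulo the Jacobson radical, so it suffices
    to find an invertible one in [K] over the semisimple ring [M_n(R/Jac R)].

    There, write [e] as a sum of primitive orthogonal idempotents [f].  Counting
    idempotents in isomorphism classes shows that [alpha(e)] and [e] are
    isomorphic, and that the [f] can be matched by an involution [f |-> f'] with
    [alpha(f)] isomorphic to [f'] and [f <> f'] except for one [f] in each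
    self-dual class of odd size.  A pair [f <> f'] contributes [v + s alpha(v)]
    for any nonzero [v] in [alpha(f') S f].  If [f = f'] and [v + s alpha(v) = 0]
    for every [v] in [alpha(f) S f], then fixing a nonzero [v], the
    anti-automorphism [r |-> v^-1 alpha(r) v] of [f S f] is the identity: hence
    [f S f] is a field, whose center [alpha] fixes.  This contradicts (1), for
    either sign, while for the class [l] with [2] invertible one of the two signs
    works. *)

(** * Identities for involutions *)

Section InvolutionTheory.
Variables (B : pzRingType) (alpha : B -> B).
Hypothesis ha : involution alpha.

Lemma invoK : involutive alpha.
Proof. by case: ha. Qed.

Lemma invoB : {morph alpha : x y / x - y}.
Proof. by case: ha => -[_ h _] _ x y; exact: h. Qed.

Lemma invoM x y : alpha (x * y) = alpha y * alpha x.
Proof. by case: ha => -[_ _ [_ h]] _; exact: h. Qed.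

Lemma invo1 : alpha 1 = 1.
Proof. by case: ha => -[_ _ [h _]] _; exact: h. Qed.

Lemma invo0 : alpha 0 = 0.
Proof. by have := invoB 0 0; rewrite !subrr. Qed.

Lemma invoN : {morph alpha : x / - x}.
Proof. by move=> x; rewrite -sub0r invoB invo0 sub0r. Qed.

Lemma invoD : {morph alpha : x y / x + y}.
Proof. by move=> x y; rewrite -{1}(opprK y) invoB invoN opprK. Qed.

Lemma invo_sum (I : finType) (Q : pred I) (F : I -> B) :
  alpha (\sum_(i | Q i) F i) = \sum_(i | Q i) alpha (F i).
Proof. exact: (big_morph alpha invoD invo0). Qed.

Lemma invo_sign (s : bool) x : alpha ((-1) ^+ s * x) = (-1) ^+ s * alpha x.
Proof. by case: s; rewrite ?expr1 ?expr0 ?mulN1r ?mul1r // invoN. Qed.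

Lemma invo_eq0 x : alpha x = 0 -> x = 0.
Proof. by move=> e; rewrite -(invoK x) e invo0. Qed.

End InvolutionTheory.

(** * Idempotents with division corner rings, and isomorphism between them *)

Section DivisionIdempotents.
Variable B : pzRingType.
Implicit Types f g x y z : B.

Definition semiprime : Prop := forall y, y <> 0 -> exists x, y * x * y <> 0.

(** The corner ring [f B f] is then a division ring: [f * z * f] is a left inverse inside the
    corner, and left inverses of all nonzero elements suffice. *)
Definition division_idempotent f : Prop :=
  [/\ f * f = f, f <> 0 &
      forall x, f * x * f <> 0 -> exists z, z * (f * x * f) = f].

(** That is, [g B f] is nonzero. For division idempotents of a semiprime ring this is isomorphism of
    [f] and [g], as [linkedP] shows. *)
Definition linked f g : Prop := exists y, g * y * f <> 0.

(** Semiprimeness gives [x] with [f * (x * y) * f] nonzero; its left inverse in the division ring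
    [f B f] yields [z] with [z * y = f]. Then [y * z] is a nonzero idempotent of the division ring
    [g B g], hence equals [g]. *)
Lemma division_corner_inv f g y : semiprime ->
  division_idempotent f -> division_idempotent g ->
  g * y = y -> y * f = y -> y <> 0 ->
  exists z, [/\ f * z = z, z * g = z, z * y = f & y * z = g].
Proof.
move=> sp [ff f0 finv] [gg g0 ginv] gy yf y0.
have [x xy] := sp y y0.
have [w ew] : exists w, w * (f * (x * y) * f) = f.
  apply: finv => e; apply: xy.
  have -> : y * x * y = y * (f * (x * y) * f) by rewrite !mulrA yf -!mulrA yf.
  by rewrite e mulr0.
have zy : f * w * f * x * g * y = f.
  have -> : f * w * f * x * g * y = f * (w * (f * (x * y) * f)).
    by rewrite -!mulrA gy yf.
  by rewrite ew ff.
set z := f * w * f * x * g in zy *.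
have fz : f * z = z by rewrite /z !mulrA ff.
have zg : z * g = z by rewrite /z -mulrA gg.
have yzyz : y * z * (y * z) = y * z by rewrite mulrA -(mulrA y) zy yf.
have gyz : g * (y * z) * g = y * z by rewrite mulrA gy -mulrA zg.
have yz0 : g * (y * z) * g <> 0.
  rewrite gyz => e; apply: f0.
  by rewrite -ff -zy mulrA -(mulrA z) e mulr0 mul0r.
have [v] := ginv _ yz0; rewrite gyz => ev.
exists z; split=> //.
by have := congr1 ( *%R^~ (y * z)) ev; rewrite /= -mulrA yzyz ev mulrA gy.
Qed.

Lemma linkedP f g : semiprime ->
  division_idempotent f -> division_idempotent g -> linked f g ->
  exists y z, [/\ g * y = y, y * f = y, f * z = z, z * g = z &
                  z * y = f /\ y * z = g].
Proof.
move=> sp df dg [y gyf]; have [ff _ _] := df; have [gg _ _] := dg.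
have [||z [fz zg zy yz]] := division_corner_inv sp df dg _ _ gyf.
- by rewrite !mulrA gg.
- by rewrite -!mulrA ff.
by exists (g * y * f), z; split=> //; rewrite ?mulrA ?gg -?mulrA ?ff.
Qed.

Lemma linked_sym f g : semiprime ->
  division_idempotent f -> division_idempotent g -> linked f g -> linked g f.
Proof.
move=> sp df dg /(linkedP sp df dg)[y [z [gy yf fz zg [zy yz]]]].
exists z; rewrite fz zg => z0; case: df => _ + _; apply.
by rewrite -zy z0 mul0r.
Qed.

Lemma linked_trans f g h : semiprime -> division_idempotent f ->
  division_idempotent g -> division_idempotent h ->
  linked f g -> linked g h -> linked f h.
Proof.
move=> sp df dg dh /(linkedP sp df dg)[y [z [gy yf fz zg [zy yz]]]].
move=> /(linkedP sp dg dh)[y' [z' [hy yg gz zh [zy' yz']]]].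
exists (y' * y); rewrite mulrA hy -mulrA yf => e.
case: df => ff + _; apply; rewrite -ff -{2}zy -(gy) -zy'.
by rewrite -!mulrA e !mulr0.
Qed.

(* The identity matrix of size [#|A|] over the division ring [f B f] factors
   through [q] coordinates; the induction is Gaussian elimination on [b]. *)
Lemma card_le_of_factorization f (K : finType) (a : K -> B) q
    (c d : 'I_q -> B) (A : {set K}) (b : K -> B) :
  division_idempotent f ->
  (forall j, c j * f = c j) -> (forall k, f * b k = b k) ->
  {in A &, forall k k', b k * (\sum_j c j * d j) * a k' = f *+ (k == k')} ->
  (#|A| <= q)%N.
Proof.
move=> [ff f0 finv]; elim: q c d A b => [|q IHq] c d A b cf fb bXa.
  rewrite leqn0 cards_eq0; apply/set0Pn => -[k kA]; apply: f0.
  by have := bXa k k kA kA; rewrite big_ord0 mulr0 mul0r eqxx.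
pose c' j := c (widen_ord (leqnSn q) j); pose d' j := d (widen_ord (leqnSn q) j).
set X := \sum_j c' j * d' j.
have eX : \sum_j c j * d j = X + c ord_max * d ord_max by rewrite big_ord_recr.
have [z|/asboolPn] := pselect (forall k, k \in A -> b k * c ord_max = 0).
  apply/leqW/(IHq c' d' A b) => [j||k k' kA k'A]; [exact: cf|exact: fb|].
  rewrite -(bXa k k') // eX -/X mulrDr mulrA z // mul0r addr0 //.
move=> /asboolPn /existsNP[k0 /not_implyP[k0A bc0]].
have fbc : f * (b k0 * c ord_max) * f = b k0 * c ord_max.
  by rewrite mulrA fb -mulrA cf.
have [w] : exists w, w * (f * (b k0 * c ord_max) * f) = f.
  by apply: finv; rewrite fbc.
rewrite fbc => ew.
(* Subtracting a multiple of the pivot row clears the last column; the products with [a k'] for [k']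
   other than [k0] do not change, since row [k0] pairs to zero with them. *)
pose b' k := b k - b k * c ord_max * w * b k0.
have b'c k : b' k * c ord_max = 0.
  by rewrite mulrBl -!mulrA ew cf subrr.
rewrite (cardsD1 k0) k0A ltnS.
apply: (IHq c' d' _ b') => [j|k|k k']; first exact: cf.
  by rewrite mulrBr !mulrA fb.
rewrite !inE => /andP[kk0 kA] /andP[k'k0 k'A].
have <- : b' k * (\sum_j c j * d j) * a k' = f *+ (k == k').
  rewrite !mulrBl bXa // -!mulrA (mulrA (b k0)) bXa // (eq_sym k0) (negbTE k'k0).
  by rewrite mulr0n !mulr0 subr0.
by rewrite eX mulrDr mulrA b'c mul0r addr0.
Qed.

End DivisionIdempotents.

(** * Involutions of a finite set lifting an involution of its classes *)

Section ClassInvolutions.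

(** Exchanges 0 with 1, 2 with 3, and so on below [c]; for odd [c] the last index stays fixed. *)
Definition pair_swap c a :=
  if odd a then a.-1 else if (a.+1 < c)%N then a.+1 else a.

Lemma pair_swap_lt c a : (a < c)%N -> (pair_swap c a < c)%N.
Proof. by rewrite /pair_swap; case: ifP => // _; [lia | case: ifP]. Qed.

Lemma pair_swapK c a : (a < c)%N -> pair_swap c (pair_swap c a) = a.
Proof.
rewrite /pair_swap => ac; case: (boolP (odd a)) => [oa|ea].
  have -> : odd a.-1 = false by lia.
  have -> : (a.-1.+1 < c)%N by lia.
  by lia.
case: (boolP (a.+1 < c)%N) => [lt|ge]; first by rewrite /= ea.
by rewrite (negbTE ea) (negbTE ge).
Qed.

Lemma odd_of_pair_swap_fix c a : (a < c)%N -> pair_swap c a = a -> odd c.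
Proof. by rewrite /pair_swap; case: ifP => oa; [lia | case: ifP; lia]. Qed.

(** Each class is enumerated. Between distinct classes [i] and [p i], of equal size, equal positions
    are matched; a class fixed by [p] is matched with itself by [pair_swap], which has a fixed point
    only for odd size. *)
Lemma involution_over_classes (Y T : finType) (cl : Y -> T) (p : T -> T) :
  involutive p ->
  (forall i, #|[set y | cl y == p i]| = #|[set y | cl y == i]|) ->
  exists tau : Y -> Y, [/\ involutive tau, forall y, cl (tau y) = p (cl y) &
    forall y, tau y = y -> odd #|[set y' | cl y' == cl y]|].
Proof.
move=> pK cardp; pose F i := enum [set y | cl y == i].
have sF i : size (F i) = #|[set y | cl y == i]| by rewrite cardE.
have sFp i : size (F (p i)) = size (F i) by rewrite !sF cardp.
pose g i a := if p i == i then pair_swap (size (F i)) a else a.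
have g_lt i a : (a < size (F i))%N -> (g i a < size (F i))%N.
  by rewrite /g; case: ifP => // _; exact: pair_swap_lt.
have gK i a : (a < size (F i))%N -> g (p i) (g i a) = a.
  by rewrite /g pK eq_sym sFp; case: (p i == i) => //; exact: pair_swapK.
pose ix y := index y (F (cl y)).
have mF y : y \in F (cl y) by rewrite mem_enum inE.
have ix_lt y : (ix y < size (F (cl y)))%N by rewrite index_mem.
have cl_nth y i a : (a < size (F i))%N -> cl (nth y (F i) a) = i.
  by move=> /(mem_nth y); rewrite mem_enum inE => /eqP.
have ix_nth y i a : (a < size (F i))%N -> ix (nth y (F i) a) = a.
  by move=> ai; rewrite /ix cl_nth // index_uniq // enum_uniq.
pose tau y := nth y (F (p (cl y))) (g (cl y) (ix y)).
have lt y : (g (cl y) (ix y) < size (F (p (cl y))))%N by rewrite sFp g_lt.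
have cl_tau y : cl (tau y) = p (cl y) by rewrite cl_nth.
exists tau; split=> [y||y ty] //.
  rewrite {1}/tau cl_tau pK {2}/tau ix_nth // gK //.
  by rewrite (set_nth_default y) ?nth_index.
have py : p (cl y) = cl y by rewrite -cl_tau ty.
rewrite -sF; apply: (@odd_of_pair_swap_fix _ (ix y)) => //.
have := ix_nth y _ _ (lt y); rewrite -/(tau y) ty.
by rewrite /g py eqxx => {2}->.
Qed.

End ClassInvolutions.

(** * Invertible symmetric or skew elements over the semisimple ring *)

Section FormOnSemisimple.
Variables (B : pzRingType) (alpha : B -> B).
Hypotheses (ha : involution alpha) (sp : semiprime B).

Lemma linked_involution f g : linked f g -> linked (alpha g) (alpha f).
Proof.
move=> [y gyf]; exists (alpha y) => e; apply: gyf.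
by apply: (invo_eq0 ha); rewrite !(invoM ha) mulrA.
Qed.

(** An involution turns right inverses into left ones, so the two-sided inverse from
    [division_corner_inv] is used. *)
Lemma division_idempotent_involution f :
  division_idempotent f -> division_idempotent (alpha f).
Proof.
move=> df; have [ff f0 _] := df; split=> [||x nz].
- by rewrite -(invoM ha) ff.
- by move/(invo_eq0 ha).
have nz' : f * alpha x * f <> 0.
  move=> e; apply: nz; apply: (invo_eq0 ha).
  by rewrite !(invoM ha) (invoK ha) mulrA.
have [||z [_ _ _ yz]] := division_corner_inv sp df df _ _ nz'.
- by rewrite !mulrA ff.
- by rewrite -!mulrA ff.
by exists (alpha z); rewrite -[in RHS]yz !(invoM ha) (invoK ha) !mulrA.
Qed.

Variables (n : nat) (k0 : 'I_n) (Y T : finType) (f : 'I_n * Y -> B).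
Variable cl : Y -> T.
Hypotheses (fd : forall x, division_idempotent (f x))
  (f_orth : forall x x', x != x' -> f x * f x' = 0)
  (f_sum : \sum_x f x = 1)
  (clP : forall x x', linked (f x) (f x') <-> cl x.2 = cl x'.2)
  (cl_surj : forall i, exists y, cl y = i).

Let afd x : division_idempotent (alpha (f x)).
Proof. exact: division_idempotent_involution. Qed.

(** Expresses that [alpha] carries class [i] to class [j] up to isomorphism; quantifying over all
    representatives spares choosing any. *)
Let dual i j := forall x x', cl x.2 = i -> cl x'.2 = j ->
  linked (f x') (alpha (f x)).

Let dual_ex i : exists j, dual i j.
Proof.
have [y cy] := cl_surj i.
have [x0 nz] : exists x', alpha (f (k0, y)) * f x' <> 0.
  apply: contrapT => /forallNP nex; have [_ + _] := afd (k0, y); apply.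
  rewrite -[LHS]mulr1 -f_sum mulr_sumr big1 // => x' _.
  exact: contrapT (nex x').
exists (cl x0.2) => x x' cx cx'.
have lk0 : linked (f x0) (alpha (f (k0, y))) by exists 1; rewrite mulr1.
have lk1 : linked (f x') (f x0) by apply/clP.
have lk2 : linked (f x) (f (k0, y)) by apply/clP; rewrite cx.
apply: (linked_trans sp) (linked_involution lk2) => //.
exact: (linked_trans sp) lk0.
Qed.

Let dual_sym i j : dual i j -> dual j i.
Proof.
move=> d x x' cx cx'; have := linked_involution (d _ _ cx' cx).
by rewrite (invoK ha).
Qed.

Let dual_uniq i j j' : dual i j -> dual i j' -> j = j'.
Proof.
move=> d d'; have [y cy] := cl_surj i.
have [y1 c1] := cl_surj j; have [y2 c2] := cl_surj j'.
rewrite -c1 -c2; apply/(clP (k0, y1) (k0, y2)).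
have l2 : linked (f (k0, y2)) (alpha (f (k0, y))) by exact: d'.
by apply: (linked_trans sp) (linked_sym sp _ _ l2) => //; exact: d.
Qed.

(** Fix [f0] in class [j]. For [x] in class [i] take [b_x] in [f0 B alpha(f x)] and [a_x] in
    [alpha(f x) B f0] with [b_x a_x = f0]; mixed products vanish by orthogonality. The sum of class
    [j] acts as [1] to the right of [b_x], and each of its terms factors through [f0], so an
    identity matrix indexed by class [i] factors through class [j]. *)
Let card_class_le i j : dual i j ->
  (#|[set x : 'I_n * Y | cl x.2 == i]| <=
     #|[set x : 'I_n * Y | cl x.2 == j]|)%N.
Proof.
move=> dij; have [y0 cy0] := cl_surj j; pose f0 := f (k0, y0).
have df0 : division_idempotent f0 by exact: fd.
have [ab abP] : exists ab : 'I_n * Y -> B * B, forall x,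
    f0 * (ab x).2 = (ab x).2 /\ (cl x.2 = i ->
      [/\ alpha (f x) * (ab x).1 = (ab x).1, (ab x).2 * alpha (f x) = (ab x).2
        & (ab x).2 * (ab x).1 = f0]).
  suff /choice[ab abP] : forall x, exists ab : B * B, f0 * ab.2 = ab.2 /\
      (cl x.2 = i -> [/\ alpha (f x) * ab.1 = ab.1, ab.2 * alpha (f x) = ab.2
                       & ab.2 * ab.1 = f0]) by exists ab.
  move=> x; have [cx|ncx] := pselect (cl x.2 = i); last first.
    by exists (0, 0); rewrite mulr0.
  have [y [z [? _ ? ? [? _]]]] := linkedP sp df0 (afd x) (dij x (k0, y0) cx cy0).
  by exists (y, z).
pose A' := [set x : 'I_n * Y | cl x.2 == j].
have [cd cdP] : exists cd : 'I_#|A'| -> B * B, forall x',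
    (cd x').1 * f0 = (cd x').1 /\ (cd x').1 * (cd x').2 = f (enum_val x').
  suff /choice[cd cdP] : forall x' : 'I_#|A'|, exists cd : B * B,
      cd.1 * f0 = cd.1 /\ cd.1 * cd.2 = f (enum_val x') by exists cd.
  move=> x'; have := enum_valP x'; rewrite inE => /eqP cx'.
  have /(linkedP sp df0 (fd _))[y [z [_ ? _ _ [_ ?]]]] :
    linked f0 (f (enum_val x')) by apply/clP; rewrite cx'.
  by exists (y, z).
apply: (@card_le_of_factorization _ f0 _ (fun x => (ab x).1) _
  (fun j => (cd j).1) (fun j => (cd j).2) _ (fun x => (ab x).2)) => //.
- by move=> x'; case: (cdP x').
- by move=> x; case: (abP x).
move=> x x'; rewrite !inE => /eqP cx /eqP cx'.
have -> : \sum_j0 (cd j0).1 * (cd j0).2 = \sum_(x1 in A') f x1.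
  by rewrite [RHS]big_enum_val; apply: eq_bigr => j0 _; case: (cdP j0).
have [fb /(_ cx)[_ bx bax]] := abP x; have [_ /(_ cx')[ax' _ _]] := abP x'.
have -> : (ab x).2 * (\sum_(x1 in A') f x1) = (ab x).2.
  rewrite -[RHS]mulr1 -f_sum (bigID (mem A') predT) /= mulrDr.
  rewrite [X in _ = _ + X]mulr_sumr [X in _ = _ + X]big1 ?addr0 // => x1.
  rewrite inE => ncx1; apply: contrapT => nz; move: ncx1.
  have /clP /= -> : linked (f x1) f0 by exists (ab x).2; rewrite fb.
  by rewrite cy0 eqxx.
have [<-//|ne] := eqVneq x x'.
by rewrite -bx -ax' mulrA -(mulrA _ (alpha (f x))) -(invoM ha) f_orth 1?eq_sym //
  (invo0 ha) mulr0 mul0r.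
Qed.

Let card_class i : #|[set x : 'I_n * Y | cl x.2 == i]| =
  (n * #|[set y | cl y == i]|)%N.
Proof.
rewrite -[n in RHS]card_ord -cardsT -cardsX; apply: eq_card => x.
by rewrite !inE.
Qed.

(** Only a self-dual class of odd size leaves an idempotent matched with itself, hence the form of
    the hypothesis. The exponent [s] encodes the sign, [true] standing for [-1]. *)
Lemma hermitian_form_semisimple (s : bool) :
    (forall y, linked (f (k0, y)) (alpha (f (k0, y))) ->
       odd #|[set y' | cl y' == cl y]| -> exists w,
       let v := alpha (f (k0, y)) * w * f (k0, y) in
       v + (-1) ^+ s * alpha v <> 0) ->
  let e := \sum_y f (k0, y) in
  exists u z, let k := u + (-1) ^+ s * alpha u in
    [/\ alpha e * u * e = u, e * z * alpha e = z, z * k = e & k * z = alpha e].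
Proof.
move=> hs e; pose g y := f (k0, y).
have [p dualp] := choice dual_ex.
have pK : involutive p.
  by move=> i; apply: (dual_uniq (dualp _)); exact: dual_sym.
(* Class sizes in ['I_n * Y] are [n] times those in [Y], and the factor [n] cancels. *)
have cardp i : #|[set y | cl y == p i]| = #|[set y | cl y == i]|.
  have n_gt0 : (0 < n)%N := leq_ltn_trans (leq0n k0) (ltn_ord k0).
  apply/eqP; rewrite -(eqn_pmul2l n_gt0) -!card_class.
  by rewrite eqn_leq !card_class_le //; exact: dual_sym.
have [tau [tauK cl_tau tau_odd]] := involution_over_classes pK cardp.
have lk y : linked (g y) (alpha (g (tau y))).
  by apply: (dualp (p (cl y))); rewrite /= ?cl_tau ?pK.
have gg y : g y * g y = g y by have [] := fd (k0, y).
have gg0 y y' : y != y' -> g y * g y' = 0.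
  by move=> ne; apply: f_orth; apply: contra ne => /eqP[->].
have aggM y y' : alpha (g y) * alpha (g y') = if y == y' then alpha (g y) else 0.
  rewrite -(invoM ha); have [<-|ne] := eqVneq y y'; first by rewrite gg.
  by rewrite gg0 1?eq_sym // (invo0 ha).
have ge y : g y * e = g y.
  rewrite mulr_sumr (bigD1 y) //= gg big1 ?addr0 // => y' ?.
  by rewrite gg0 1?eq_sym.
have eg y : e * g y = g y.
  by rewrite mulr_suml (bigD1 y) //= gg big1 ?addr0 // => y' ?; rewrite gg0.
have /choice[v vP] : forall y, exists v, 
    [/\ alpha (g (tau y)) * v = v, v * g y = v &
    if tau y == y then v + (-1) ^+ s * alpha v <> 0 else v <> 0].
  move=> y; have [ty|ty] := eqVneq (tau y) y; last first.
    have [w nz] := lk y; exists (alpha (g (tau y)) * w * g y).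
    by rewrite !mulrA aggM eqxx -[_ * g y * g y]mulrA gg.
  have [||w nz] := hs y; first by have := lk y; rewrite ty.
    exact: tau_odd.
  rewrite -/(g y) in nz; exists (alpha (g y) * w * g y).
  by rewrite ty !mulrA aggM eqxx -[_ * g y * g y]mulrA gg.
(* The rank selects one member of each pair [y], [tau y], so that only one contributes to [u]; a
   fixed point is always selected. *)
pose r y := (enum_rank y <= enum_rank (tau y))%N.
pose u y := if r y then v y else 0.
have gu y : alpha (g (tau y)) * u y = u y.
  by rewrite /u; case: ifP; rewrite ?mulr0 //; case: (vP y).
have ug y : u y * g y = u y.
  by rewrite /u; case: ifP; rewrite ?mul0r //; case: (vP y).
pose k y := u y + (-1) ^+ s * alpha (u (tau y)).
have gk y : alpha (g (tau y)) * k y = k y.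
  by rewrite mulrDr gu mulrA commr_sign -mulrA -(invoM ha) ug.
have kg y : k y * g y = k y.
  rewrite mulrDl ug -mulrA; congr (_ + _ * _).
  by rewrite -[in RHS](gu (tau y)) tauK (invoM ha) (invoK ha).
(* In a genuine pair exactly one of the two summands of [k y] is nonzero; at a fixed point the
   choice of [v] applies. *)
have k_neq0 y : k y <> 0.
  rewrite /k /u /r tauK; have [_ _] := vP y; have [_ _] := vP (tau y).
  have [ty|ty] := eqVneq (tau y) y; first by rewrite ty leqnn.
  rewrite tauK (eq_sym y) (negbTE ty) => nz1 nz2.
  have := ty; rewrite -(inj_eq enum_rank_inj) -(inj_eq val_inj) /=.
  case: ltngtP => // _ _; first by rewrite (invo0 ha) mulr0 addr0.
  rewrite add0r => /(congr1 ( *%R ((-1) ^+ s))).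
  by rewrite mulrA -expr2 sqrr_sign mul1r mulr0 => /(invo_eq0 ha).
have /choice[z zP] : forall y, exists z, 
    [/\ g y * z = z, z * alpha (g (tau y)) = z,
    z * k y = g y & k y * z = alpha (g (tau y))].
  move=> y; exact: (division_corner_inv sp (fd (k0, y)) (afd (k0, tau y))
    (gk y) (kg y) (@k_neq0 y)).
have sum_k : \sum_y u y + (-1) ^+ s * alpha (\sum_y u y) = \sum_y k y.
  rewrite big_split /= -mulr_sumr (invo_sum ha); congr (_ + _ * _).
  by rewrite (reindex_inj (inv_inj tauK)).
have ae : alpha e = \sum_y alpha (g (tau y)).
  by rewrite (invo_sum ha) (reindex_inj (inv_inj tauK)).
exists (\sum_y u y), (\sum_y z y); rewrite sum_k; split.
- rewrite mulr_sumr mulr_suml; apply: eq_bigr => y _.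
  rewrite -gu -[in LHS]ug !mulrA -(invoM ha) ge -!mulrA.
  by rewrite ge ug.
- rewrite mulr_sumr mulr_suml; apply: eq_bigr => y _; have [gz zg _ _] := zP y.
  by rewrite -zg -{1}gz !mulrA eg -!mulrA -(invoM ha) eg zg gz.
- rewrite mulr_suml; apply: eq_bigr => y _; have [_ zg zk _] := zP y.
  rewrite mulr_sumr (bigD1 y) //= zk big1 ?addr0 // => y' ne.
  rewrite -zg -gk mulrA -(mulrA (z y)) aggM (inj_eq (inv_inj tauK)) eq_sym.
  by rewrite (negbTE ne) mulr0 mul0r.
rewrite ae mulr_suml; apply: eq_bigr => y _; have [_ _ _ kz] := zP y.
rewrite mulr_sumr (bigD1 y) //= kz big1 ?addr0 // => y' ne.
have [gz _ _ _] := zP y'.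
by rewrite -kg -gz mulrA -(mulrA (k y)) gg0 1?eq_sym // mulr0 mul0r.
Qed.

End FormOnSemisimple.

(** * Quasi-regularity of matrices with entries in the Jacobson radical *)

Section JacobsonRadical.

Lemma left_ideal_sub_maximal (R : pzRingType) (I0 : set R) :
  left_ideal I0 -> ~ I0 1 ->
  exists2 M, maximal_left_ideal M & (I0 `<=` M)%classic.
Proof.
move=> [I00 I0D I0M] nI1.
(* adjoining [I0] makes the empty chain harmless in Zorn's lemma *)
pose Q (A : set R) := left_ideal (A `|` I0)%classic /\ ~ (A `|` I0)%classic 1.
have [F FQ Ftot|A [[idA nA1] maxA]] := @Zorn_bigcup R Q.
  split; last by case=> // -[A FA A1]; case: (FQ _ FA) => _; apply; left.
  split=> [|x y|a x].
  - by right.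
  - case=> [[A FA Ax]|Ix]; case=> [[A' FA' A'y]|Iy].
    + have [sAA'|sA'A] := Ftot _ _ FA FA'.
        case: (FQ _ FA') => -[_ D _] _.
        have [] := D x y (or_introl (sAA' _ Ax)) (or_introl A'y); last by right.
        by move=> ?; left; exists A'.
      case: (FQ _ FA) => -[_ D _] _.
      have [] := D x y (or_introl Ax) (or_introl (sA'A _ A'y)); last by right.
      by move=> ?; left; exists A.
    + case: (FQ _ FA) => -[_ D _] _.
      have [] := D x y (or_introl Ax) (or_intror Iy); last by right.
      by move=> ?; left; exists A.
    + case: (FQ _ FA') => -[_ D _] _.
      have [] := D x y (or_intror Ix) (or_introl A'y); last by right.
      by move=> ?; left; exists A'.
    + by right; exact: I0D.
  - case=> [[A FA Ax]|Ix]; last by right; exact: I0M.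
    case: (FQ _ FA) => -[_ _ D] _.
    have [] := D a x (or_introl Ax); last by right.
    by move=> ?; left; exists A.
exists (A `|` I0)%classic; last by move=> x; right.
split=> // [e|J [J0 JD JM] sJ nJ]; first by apply: nA1; rewrite e.
have J1 : ~ J 1.
  move=> J1; apply: nJ; apply/seteqP; split=> // x _.
  by rewrite -(mulr1 x); exact: JM.
apply/seteqP; split=> // x Jx; apply: contrapT => nAx.
have eJ : (J `|` I0)%classic = J.
  by apply/seteqP; split=> y; [case=> // Iy; apply: sJ; right | left].
apply: (maxA J); last by rewrite /Q eJ.
split; first by move=> y Ay; apply: sJ; left.
by move=> sJA; apply: nAx; left; exact: sJA.
Qed.

Lemma jac_left_inverse (R : pzRingType) (r : R) :
  r \in @jac R -> exists u, u * (1 + r) = 1.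
Proof.
move=> /jacP jr; apply: contrapT => /forallNP nu.
pose I0 := [set x | exists a, x = a * (1 + r)]%classic.
have idI0 : left_ideal I0.
  split=> [|x y [a ->] [b ->]|a x [b ->]].
  - by exists 0; rewrite mul0r.
  - by exists (a + b); rewrite mulrDl.
  - by exists (a * b); rewrite mulrA.
have [|M mM sM] := left_ideal_sub_maximal idI0.
  by move=> [a e]; apply: (nu a).
have Mr := jr _ mM; case: mM => -[_ MD MM] + _; apply.
apply/seteqP; split=> // x _; rewrite -(mulr1 x); apply: (MM x).
have -> : 1 = (1 + r) + (-1) * r by rewrite mulN1r addrK.
by apply: MD; [apply: sM; exists 1; rewrite mul1r | exact: MM].
Qed.

Variables (R : pzRingType) (n : nat).
Implicit Types X Z : 'M[R]_n.

(* A left inverse [1 - Z v] for a matrix [Z] supported on a single column; sums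
   of left ideals consisting of left quasi-regular elements again consist of such
   elements, which reduces the general case to this one. *)
Lemma column_left_inverse Z (j0 : 'I_n) :
  (forall i j, Z i j \in @jac R) -> (forall i j, j != j0 -> Z i j = 0) ->
  exists U : 'M[R]_n, U * (1 + Z) = 1.
Proof.
move=> jZ Z0; have [v ev] := jac_left_inverse (jZ j0 j0).
exists (1 - \matrix_(i, j) (Z i j * v)).
rewrite mulrBl mul1r mulrDr mulr1 -addrA -[RHS]addr0; congr (_ + _).
apply/matrixP => i j; rewrite !mxE (bigD1 j0) //= big1 => [|l lj0]; last first.
  by rewrite mxE (Z0 i l lj0) !mul0r.
rewrite !mxE addr0; have [->|jj0] := eqVneq j j0; last first.
  by rewrite !(Z0 _ j jj0) mul0r mulr0 addr0 subrr.
by rewrite -mulrA -mulrDr -[X in Z i j0 * (X + _)]mulr1 -mulrDr ev mulr1 subrr.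
Qed.

(** Induction on the number of columns: if [U] inverts [1 + X1] on the left, where [X1] omits column
    [k], then [U * (1 + X) = 1 + U * X2] with [U * X2] supported on column [k]. *)
Lemma columns_left_inverse k X :
  (forall i j, X i j \in @jac R) ->
  (forall i (j : 'I_n), (k <= j)%N -> X i j = 0) ->
  exists U : 'M[R]_n, U * (1 + X) = 1.
Proof.
elim: k X => [|k IHk] X jX X0.
  exists 1; rewrite mul1r [X](_ : _ = 0) ?addr0 //.
  by apply/matrixP => i j; rewrite mxE X0.
pose X1 : 'M[R]_n := \matrix_(i, j) (if j == k :> nat then 0 else X i j).
pose X2 : 'M[R]_n := \matrix_(i, j) (if j == k :> nat then X i j else 0).
have [||U eU] := IHk X1 => [i j|i j kj|].
- by rewrite mxE; case: ifP => // _; exact: rpred0.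
- by rewrite mxE; case: eqP => // jk; apply: X0; lia.
have jUX2 i j : (U * X2) i j \in @jac R.
  rewrite mxE; apply: rpred_sum => l _; apply: jac_mull.
  by rewrite mxE; case: ifP => // _; exact: rpred0.
have -> : 1 + X = (1 + X1) + X2.
  rewrite -addrA; congr (_ + _); apply/matrixP => i j; rewrite !mxE.
  by case: ifP; rewrite ?add0r ?addr0.
have [kn|nk] := ltnP k n; last first.
  exists U; rewrite mulrDr eU [X2](_ : _ = 0) ?mulr0 ?addr0 //.
  apply/matrixP => i j; rewrite !mxE; case: eqP => // jk.
  by have := ltn_ord j; lia.
have [||W eW] := @column_left_inverse (U * X2) (Ordinal kn) => // [i j jk|].
  rewrite mxE big1 // => l _; rewrite mxE.
  by move: jk; rewrite -(inj_eq val_inj) /= => /negbTE->; rewrite mulr0.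
by exists (W * U); rewrite -mulrA mulrDr eU.
Qed.

(** The left inverse [U = 1 - U * X] has the same shape as [1 + X], so it has a left inverse too,
    which must be [1 + X]. *)
Lemma jac_mx_inverse X : (forall i j, X i j \in @jac R) ->
  exists U : 'M[R]_n, U * (1 + X) = 1 /\ (1 + X) * U = 1.
Proof.
move=> jX; have [|U eU] := columns_left_inverse (k := n) jX.
  by move=> i j; have := ltn_ord j; lia.
have [W eW] : exists W : 'M[R]_n, W * U = 1.
  have -> : U = 1 + - (U * X) by rewrite -eU mulrDr mulr1 addrK.
  apply: (columns_left_inverse (k := n)) => i j; last by have := ltn_ord j; lia.
  rewrite !mxE rpredN; apply: rpred_sum => l _; exact: jac_mull.
exists U; split=> //; have <- : W = 1 + X.
  by rewrite -[LHS]mulr1 -[in LHS]eU mulrA eW mul1r.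
exact: eW.
Qed.

End JacobsonRadical.

(** * Lifting along a surjection with quasi-regular kernel *)

Section Lifting.
Variables (S B : pzRingType) (P : {rmorphism S -> B}).
Hypotheses (P_surj : forall b, exists x, P x = b)
  (P_ker : forall x, P x = 0 -> exists u, u * (1 + x) = 1 /\ (1 + x) * u = 1).
Variable alpha : S -> S.
Hypothesis ha : involution alpha.

(** If [b] is nonzero, so is some [b * f i], and then [w * f i * x * b * f i = f i] for some [w] and
    [x]. With [c = - (w * f i * x)] and [d = f i], the element [1 + c * b * d = 1 - f i] kills
    [f i], so it has no left inverse. *)
Lemma division_idempotents_no_radical (I : finType) (f : I -> B) (b : B) :
  semiprime B -> (forall i, division_idempotent (f i)) -> \sum_i f i = 1 ->
  (forall c d, exists u, u * (1 + c * b * d) = 1) -> b = 0.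
Proof.
move=> sp fd f1 rad; apply: contrapT => b0.
have [i nz] : exists i, b * f i <> 0.
  apply: contrapT => /forallNP nex; apply: b0.
  by rewrite -[b]mulr1 -f1 mulr_sumr big1 // => i _; exact: contrapT (nex i).
have [x xy] := sp _ nz; have [ff f0 finv] := fd i.
have [w ew] : exists w, w * (f i * (x * b) * f i) = f i.
  by apply: finv => e; apply: xy; rewrite -!mulrA in e *; rewrite e mulr0.
have [u] := rad (- (w * f i * x)) (f i); rewrite !mulNr.
have -> : w * f i * x * b * f i = f i by rewrite -[RHS]ew !mulrA.
move=> eu; apply: f0; rewrite -[LHS]mul1r -eu -mulrA mulrBl mul1r ff subrr.
by rewrite mulr0.
Qed.

Lemma involution_quotient : (forall x, P x = 0 -> P (alpha x) = 0) ->
  exists abar : B -> B, involution abar /\ forall x, abar (P x) = P (alpha x).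
Proof.
move=> Pa; have [sec secP] := choice P_surj.
pose abar b := P (alpha (sec b)).
have abarP x : abar (P x) = P (alpha x).
  apply/eqP; rewrite -subr_eq0 -rmorphB -(invoB ha); apply/eqP/Pa.
  by rewrite rmorphB secP subrr.
have abarK : involutive abar.
  by move=> b; rewrite {2}/abar abarP (invoK ha) secP.
exists abar; split=> //; split=> //; split.
- by exists abar.
- move=> a b; rewrite -(secP a) -(secP b) -rmorphB !abarP (invoB ha) rmorphB //.
- split; first by rewrite -(rmorph1 P) abarP (invo1 ha) rmorph1.
  move=> a b; rewrite -(secP a) -(secP b).
  by rewrite -[X in abar X](rmorphM P) !abarP (invoM ha) (rmorphM P).
Qed.

Lemma hermitian_form_lift (abar : B -> B) (s : bool) e u z :
    (forall x, abar (P x) = P (alpha x)) -> e * e = e ->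
    let k := u + (-1) ^+ s * abar u in
    [/\ abar (P e) * u * P e = u, P e * z * abar (P e) = z,
        z * k = P e & k * z = abar (P e)] ->
  exists k' z', [/\ alpha k' = (-1) ^+ s * k',
    alpha e * k' = k' /\ k' * e = k', e * z' = z' /\ z' * alpha e = z',
    z' * k' = e & k' * z' = alpha e].
Proof.
move=> abarP ee k [eu ez zk kz].
have aee : alpha e * alpha e = alpha e by rewrite -(invoM ha) ee.
have [u0 Pu0] := P_surj u; have [z0 Pz0] := P_surj z.
pose u1 := alpha e * u0 * e; pose k1 := u1 + (-1) ^+ s * alpha u1.
pose z1 := e * z0 * alpha e.
have Pu1 : P u1 = u by rewrite !rmorphM Pu0 -abarP.
have Pk1 : P k1 = k.
  rewrite rmorphD Pu1 rmorphM -abarP Pu1; congr (_ + _ * _).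
  by rewrite rmorphXn rmorphN rmorph1.
have Pz1 : P z1 = z by rewrite !rmorphM Pz0 -abarP.
have au1 : alpha u1 = alpha e * alpha u0 * e.
  by rewrite !(invoM ha) (invoK ha) mulrA.
have ak : alpha k1 = (-1) ^+ s * k1.
  rewrite (invoD ha) (invo_sign ha) (invoK ha) mulrDr mulrA -expr2 sqrr_sign.
  by rewrite mul1r addrC.
have ek : alpha e * k1 = k1.
  rewrite /k1 mulrDr [X in _ + X]mulrA commr_sign -mulrA au1; congr (_ + _ * _);
  by rewrite /u1 !mulrA aee.
have ke : k1 * e = k1.
  rewrite /k1 mulrDl -[X in _ + X]mulrA au1; congr (_ + _ * _);
  by rewrite /u1 -!mulrA ee.
have ez1 : e * z1 = z1 by rewrite /z1 !mulrA ee.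
have z1e : z1 * alpha e = z1 by rewrite /z1 -!mulrA aee.
(* Both [z1 * k1 - e] and [k1 * z1 - alpha e] lie in the kernel, so [v] and [w] correct [z1] to a
   left and a right inverse of [k1], which coincide. *)
clearbody k1 z1; have [|v [v1 _]] := @P_ker (z1 * k1 - e).
  by rewrite rmorphB rmorphM Pz1 Pk1 zk subrr.
have [|w [_ w1]] := @P_ker (k1 * z1 - alpha e).
  by rewrite rmorphB rmorphM Pz1 Pk1 kz -abarP subrr.
have z2k : e * v * z1 * k1 = e.
  rewrite -[RHS]ee -[X in _ = e * X]mul1r -v1 -!mulrA; congr (_ * (_ * _)).
  by rewrite mulrDl mul1r mulrBl ee -mulrA ke addrC subrK.
have kz3 : k1 * (z1 * w * alpha e) = alpha e.
  rewrite -[RHS]aee -[X in _ = X * alpha e]mulr1 -w1 !mulrA; congr (_ * _ * _).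
  by rewrite mulrDr mulr1 mulrBr aee mulrA ek addrC subrK.
have ez23 : e * v * z1 = z1 * w * alpha e.
  have <- : e * (z1 * w * alpha e) = z1 * w * alpha e by rewrite !mulrA ez1.
  by rewrite -[X in _ = X * _]z2k -[RHS]mulrA kz3 -[RHS]mulrA z1e.
exists k1, (e * v * z1); split=> //; last by rewrite ez23.
by split; [rewrite !mulrA ee | rewrite -mulrA z1e].
Qed.

End Lifting.

(** * Idempotents for which all symmetrized elements vanish *)

Section TraceFree.
Variables (B : pzRingType) (alpha : B -> B).
Hypotheses (ha : involution alpha) (sp : semiprime B).
Implicit Types f g r y : B.

Definition has_trace (s : bool) f : Prop := exists w,
  let v := alpha f * w * f in v + (-1) ^+ s * alpha v <> 0.

Lemma trace_free_skew s f v : ~ has_trace s f ->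
  alpha f * v = v -> v * f = v -> v + (-1) ^+ s * alpha v = 0.
Proof.
move=> ntr fv vf; apply: contrapT => nz; apply: ntr; exists v.
by rewrite /= fv vf.
Qed.

(** Both [y] and [y * r] lie in [alpha(f) B f], where every [x] equals [- s alpha(x)]; comparing the
    two identities moves [r] across [y]. *)
Lemma trace_free_adjoint s f y r : ~ has_trace s f ->
  alpha f * y = y -> y * f = y -> r * f = r ->
  alpha r * y = y * r.
Proof.
move=> ntr fy yf rf.
have e1 := trace_free_skew ntr fy yf.
have e2 : y * r + (-1) ^+ s * alpha (y * r) = 0.
  by apply: (trace_free_skew ntr); rewrite ?mulrA ?fy // -mulrA rf.
apply/eqP; rewrite -subr_eq0; apply/eqP; rewrite -[LHS](addrK 0) subr0.
rewrite -[X in _ + X]e2 addrA subrK (invoM ha) mulrA -commr_sign -mulrA -mulrDr.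
by rewrite e1 mulr0.
Qed.

(** By [trace_free_adjoint] an anti-automorphism of [f B f] is the identity, so products in this
    ring commute. *)
Lemma trace_free_commutative s f r r' :
  division_idempotent f -> linked f (alpha f) -> ~ has_trace s f ->
  f * r = r -> r * f = r -> f * r' = r' -> r' * f = r' -> r * r' = r' * r.
Proof.
move=> df lk ntr fr rf fr' r'f.
have [y [z [fy yf _ _ [zy _]]]] :=
  linkedP sp df (division_idempotent_involution ha sp df) lk.
have : y * (r * r') = y * (r' * r).
  rewrite -(trace_free_adjoint ntr fy yf) -?mulrA ?r'f //.
  rewrite (invoM ha) -mulrA (trace_free_adjoint ntr fy yf) // mulrA.
  by rewrite (trace_free_adjoint ntr fy yf) // mulrA.
by move/(congr1 ( *%R z)); rewrite !(mulrA z) zy !mulrA fr fr'.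
Qed.

Lemma trace_free_central s f c :
  division_idempotent f -> linked f (alpha f) -> ~ has_trace s f ->
  (forall x, c * x = x * c) -> (forall x, alpha c * x = x * alpha c) ->
  (alpha c - c) * f = 0.
Proof.
move=> df lk ntr cC acC; have [ff _ _] := df.
have [y [z [fy yf _ _ [zy _]]]] :=
  linkedP sp df (division_idempotent_involution ha sp df) lk.
have : alpha (c * f) * y = y * (c * f).
  by apply: (trace_free_adjoint ntr) => //; rewrite -mulrA ff.
rewrite (invoM ha) -acC -mulrA fy mulrA -cC -mulrA yf => e.
rewrite -zy mulrA mulrBl acC cC -mulrBr -mulrA mulrBl.
by rewrite e subrr mulr0.
Qed.

(** The two signs may fail at different idempotents of one class, hence [f] and [g]. An invertible
    [v] at [g] with [alpha(v) = - v] is transported to [alpha(u) v u] at [f], which is skew as well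
    but must be symmetric by the other sign; so [2 v = 0], and [v] cancels. *)
Lemma trace_free_both_signs f g :
  division_idempotent f -> division_idempotent g -> linked f g ->
  linked g (alpha g) -> ~ has_trace false g -> ~ has_trace true f ->
  g + g = 0.
Proof.
move=> df dg /(linkedP sp df dg)[u [w [gu uf _ _ [_ uw]]]] lk.
have [v [z [gv vg _ _ [zv _]]]] :=
  linkedP sp dg (division_idempotent_involution ha sp dg) lk.
move=> /trace_free_skew/(_ gv vg); rewrite expr0 mul1r => sv.
move=> ntr; have := trace_free_skew (v := alpha u * v * u) ntr.
rewrite expr1 mulN1r !(invoM ha) (invoK ha).
have -> : alpha f * (alpha u * v * u) = alpha u * v * u.
  by rewrite !mulrA -(invoM ha) uf.
rewrite -[_ * u * f]mulrA uf => /(_ erefl erefl).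
have {sv} -> : alpha v = - v by apply/eqP; rewrite -addr_eq0 addrC sv.
rewrite !mulNr mulrN opprK mulrA => e.
have := congr1 (fun x => alpha w * x * w) e.
rewrite mulr0 mul0r mulrDr mulrDl.
have -> : alpha w * (alpha u * v * u) * w = v.
  by rewrite !mulrA -(invoM ha) uw gv -mulrA uw vg.
by move/(congr1 ( *%R z)); rewrite mulr0 mulrDr zv.
Qed.

End TraceFree.

(** * Scaled matrix units *)

Section EntryMatrices.
Variables (A : pzRingType) (n : nat).
Implicit Types (k l : 'I_n) (x y : A).

Definition entry_mx k l x : 'M[A]_n :=
  \matrix_(i, j) (if (i == k) && (j == l) then x else 0).

Lemma entry_mxE k l x : entry_mx k l x k l = x.
Proof. by rewrite mxE !eqxx. Qed.

Lemma entry_mx_inj k l : injective (entry_mx k l).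
Proof. by move=> x y e; rewrite -(entry_mxE k l x) e entry_mxE. Qed.

Lemma entry_mx0 k l : entry_mx k l 0 = 0.
Proof. by apply/matrixP => i j; rewrite !mxE if_same. Qed.

Lemma entry_mxD k l x y :
  entry_mx k l (x + y) = entry_mx k l x + entry_mx k l y.
Proof. by apply/matrixP => i j; rewrite !mxE; case: ifP; rewrite ?addr0. Qed.

Lemma entry_mxB k l x y :
  entry_mx k l (x - y) = entry_mx k l x - entry_mx k l y.
Proof. by apply/matrixP => i j; rewrite !mxE; case: ifP; rewrite ?subr0. Qed.

Lemma entry_mx_sum k l (I : finType) (F : I -> A) :
  entry_mx k l (\sum_i F i) = \sum_i entry_mx k l (F i).
Proof. exact: (big_morph _ (entry_mxD k l) (entry_mx0 k l)). Qed.

Lemma mul_entry_mx k l x (X : 'M[A]_n) k' l' y :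
  entry_mx k l x * X * entry_mx k' l' y = entry_mx k l' (x * X l k' * y).
Proof.
apply/matrixP => i j; rewrite !mxE (bigD1 k') //= [X in _ + X]big1 => [|r rk].
  rewrite addr0 !mxE eqxx /= (bigD1 l) //= [X in _ + X]big1 => [|r rl].
    rewrite !mxE eqxx addr0 andbT.
    by case: eqP => _; case: eqP => _ //=; rewrite ?mulr0 ?mul0r.
  by rewrite !mxE (negbTE rl) andbF mul0r.
by rewrite !mxE (negbTE rk) mulr0.
Qed.

Lemma mul_entry_mx2 k l x k' l' y :
  entry_mx k l x * entry_mx k' l' y =
    if l == k' then entry_mx k l' (x * y) else 0.
Proof.
have := mul_entry_mx k l x 1 k' l' y; rewrite mulr1 => ->.
by rewrite mxE; case: eqP; rewrite ?mulr1 // mulr0 mul0r entry_mx0.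
Qed.

Lemma mulmx_entry_mx (X Z : 'M[A]_n) k l x i j :
  (X * entry_mx l k x * Z) i j = X i l * x * Z k j.
Proof.
rewrite mxE (bigD1 k) //= [X in _ + X]big1 => [|r rk].
  rewrite addr0 mxE (bigD1 l) //= [X in _ + X]big1 => [|r rl].
    by rewrite addr0 entry_mxE.
  by rewrite mxE (negbTE rl) mulr0.
by rewrite mxE big1 ?mul0r // => s _; rewrite mxE (negbTE rk) andbF mulr0.
Qed.

Lemma sum_entry_mx1 : \sum_k entry_mx k k 1 = 1.
Proof.
apply/matrixP => i j; rewrite summxE (bigD1 i) //= big1 => [|k ki].
  by rewrite !mxE eqxx addr0 eq_sym; case: eqP.
by rewrite mxE eq_sym (negbTE ki).
Qed.

Lemma semiprime_mx : semiprime A -> semiprime 'M[A]_n.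
Proof.
move=> sp X X0; have [k [l Xkl]] : exists k l, X k l <> 0.
  apply: contrapT => nex; apply: X0; apply/matrixP => k l; rewrite mxE.
  by apply: contrapT => ne; apply: nex; exists k, l.
have [x nz] := sp _ Xkl; exists (entry_mx l k x) => e; apply: nz.
by rewrite -mulmx_entry_mx e mxE.
Qed.

Lemma division_idempotent_mx k f :
  division_idempotent f -> division_idempotent (entry_mx k k f).
Proof.
move=> [ff f0 finv]; split=> [||X].
- by rewrite mul_entry_mx2 eqxx ff.
- by rewrite -(entry_mx0 k k) => /entry_mx_inj.
rewrite mul_entry_mx => nz; have [|z ez] := finv (X k k).
  by move=> e; apply: nz; rewrite e entry_mx0.
by exists (entry_mx k k z); rewrite mul_entry_mx2 eqxx ez.
Qed.

Lemma linked_mx k l f g : linked (entry_mx k k f) (entry_mx l l g) <-> linked f g.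
Proof.
split=> [[X]|[x nz]].
  rewrite mul_entry_mx => nz; exists (X l k) => e; apply: nz.
  by rewrite e entry_mx0.
exists (entry_mx l k x); rewrite mul_entry_mx entry_mxE.
by rewrite -(entry_mx0 l k) => /entry_mx_inj.
Qed.

End EntryMatrices.

(** * Diagonal idempotents in a product of matrix rings over division rings *)

Section ProductComponents.
Variables (A : pzRingType) (t : nat) (D : 'I_t -> unitRingType).
Variables (m : 'I_t -> nat) (phi : forall i, {rmorphism A -> 'M[D i]_(m i)}).
Hypotheses (hD : forall i, division_ring (D i)) (hphi : product_iso phi).

Lemma product_iso_inj x y : (forall i, phi i x = phi i y) -> x = y.
Proof.
move=> e; apply: (bij_inj hphi).
exact: functional_extensionality_dep.
Qed.

Lemma product_iso_component :
  exists emb : forall i, 'M[D i]_(m i) -> A, forall i M,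
    phi i (emb i M) = M /\ forall j, j != i -> phi j (emb i M) = 0.
Proof.
have [psi _ psiK] := hphi.
have psiE w i : phi i (psi w) = w i.
  exact: (congr1 (fun g : forall i, 'M[D i]_(m i) => g i) (psiK w)).
exists (fun i M => psi (dfwith (fun j => 0 : 'M[D j]_(m j)) M)) => i M.
by split=> [|j ji]; rewrite psiE ?dfwith_in // dfwith_out // eq_sym.
Qed.

Variable emb : forall i, 'M[D i]_(m i) -> A.
Arguments emb : clear implicits.
Hypothesis embP : forall i M,
  phi i (emb i M) = M /\ forall j, j != i -> phi j (emb i M) = 0.

Lemma phi_emb i M : phi i (emb i M) = M.
Proof. by case: (embP M). Qed.

Lemma phi_emb_neq i j M : j != i -> phi j (emb i M) = 0.
Proof. by case: (embP M) => _; apply. Qed.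

Lemma emb_inj i : injective (emb i).
Proof. by move=> M N e; rewrite -(phi_emb M) e phi_emb. Qed.

Lemma emb0 i : emb i 0 = 0.
Proof.
apply: product_iso_inj => j; rewrite rmorph0.
by have [->|ji] := eqVneq j i; [rewrite phi_emb | rewrite phi_emb_neq].
Qed.

Lemma embD i M N : emb i (M + N) = emb i M + emb i N.
Proof.
apply: product_iso_inj => j; rewrite rmorphD.
have [->|ji] := eqVneq j i; first by rewrite !phi_emb.
by rewrite !phi_emb_neq // addr0.
Qed.

Lemma mul_emb i M x : emb i M * x = emb i (M * phi i x).
Proof.
apply: product_iso_inj => j; rewrite rmorphM.
have [->|ji] := eqVneq j i; first by rewrite !phi_emb.
by rewrite !phi_emb_neq // mul0r.
Qed.

Lemma emb_mul i M x : x * emb i M = emb i (phi i x * M).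
Proof.
apply: product_iso_inj => j; rewrite rmorphM.
have [->|ji] := eqVneq j i; first by rewrite !phi_emb.
by rewrite !phi_emb_neq // mulr0.
Qed.

Lemma emb_mul_emb i M N : emb i M * emb i N = emb i (M * N).
Proof. by rewrite mul_emb phi_emb. Qed.

Lemma emb_mul_emb_neq i j M N : i != j -> emb i M * emb j N = 0.
Proof. by move=> ij; rewrite mul_emb phi_emb_neq // mulr0 emb0. Qed.

Lemma sum_emb1 : \sum_i emb i 1 = 1.
Proof.
apply: product_iso_inj => j; rewrite rmorph1 rmorph_sum (bigD1 j) //=.
by rewrite phi_emb big1 ?addr0 // => i ij; rewrite phi_emb_neq // eq_sym.
Qed.

Lemma semiprime_product : semiprime A.
Proof.
move=> y y0; have [i [a [b ab]]] : exists i a b, phi i y a b <> 0.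
  apply: contrapT => nex; apply: y0; apply: product_iso_inj => i.
  rewrite rmorph0; apply/matrixP => a b; rewrite mxE.
  by apply: contrapT => ne; apply: nex; exists i, a, b.
exists (emb i (entry_mx b a 1)) => e; apply: ab.
have := congr1 (fun x => phi i x a b) e.
rewrite /= !rmorphM rmorph0 phi_emb mulmx_entry_mx mulr1 mxE => e'.
apply/eqP/negPn/negP => /hD u.
by have := unitr0 (D i); rewrite -e' unitrMl // u.
Qed.

(** For [y = (i, a)] this is the diagonal matrix unit at [a] in factor [i]; the tag [i] labels its
    isomorphism class, and its corner ring is a copy of [D i]. *)
Definition matrix_idempotent (y : {i & 'I_(m i)}) : A :=
  emb (tag y) (entry_mx (tagged y) (tagged y) 1).
Local Notation E := matrix_idempotent.

Lemma matrix_idempotent_division y : division_idempotent (E y).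
Proof.
case: y => i a; rewrite /E /=; split=> [||x].
- by rewrite emb_mul_emb mul_entry_mx2 eqxx mulr1.
- rewrite -(emb0 i) => /emb_inj; rewrite -(entry_mx0 _ a a) => /entry_mx_inj.
  exact/eqP/oner_neq0.
rewrite mul_emb emb_mul_emb mul_entry_mx mul1r mulr1 => nz.
have u : phi i x a a \is a GRing.unit.
  apply: hD; apply/eqP => e; apply: nz.
  by rewrite e entry_mx0 emb0.
exists (emb i (entry_mx a a (phi i x a a)^-1)).
by rewrite emb_mul_emb mul_entry_mx2 eqxx mulVr.
Qed.

Lemma matrix_idempotent_orth y y' : y != y' -> E y * E y' = 0.
Proof.
case: y y' => i a [j b]; rewrite /E /= => ne.
have [ij|ij] := eqVneq i j; last exact: emb_mul_emb_neq.
case: j / ij b ne => b ne; rewrite emb_mul_emb mul_entry_mx2.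
by case: eqP => [ab|_]; [rewrite ab eqxx in ne | rewrite emb0].
Qed.

Lemma sum_matrix_idempotent : \sum_y E y = 1.
Proof.
rewrite -sum_emb1 -(@sig_big_dep _ _ _ _ (fun i => 'I_(m i)) predT (fun _ _ => true)
  (fun i a => emb i (entry_mx a a 1))) /=.
apply: eq_bigr => i _; rewrite -sum_entry_mx1 [RHS](big_morph _ (@embD i) (emb0 i)).
by [].
Qed.

Lemma linked_matrix_idempotent y y' :
  linked (E y) (E y') <-> tag y = tag y'.
Proof.
case: y y' => i a [j b]; rewrite /E /=; split=> [[x nz]|ij].
  apply/eqP/negPn/negP => ij; apply: nz.
  by rewrite mul_emb emb_mul_emb_neq // eq_sym.
case: j / ij b => b; exists (emb i (entry_mx b a 1)).
rewrite !emb_mul_emb !mul_entry_mx2 eqxx mul_entry_mx2 eqxx !mulr1.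
rewrite -(emb0 i) => /emb_inj; rewrite -(entry_mx0 _ b a) => /entry_mx_inj.
exact/eqP/oner_neq0.
Qed.

Lemma card_tag i : #|[set y : {i & 'I_(m i)} | tag y == i]| = m i.
Proof.
rewrite -sum1_card (eq_bigl (fun y => (tag y == i) && true)) => [|y].
  rewrite -(@sig_big_dep _ _ _ _ _ (pred1 i) (fun _ _ => true) (fun _ _ => 1%N)).
  by rewrite big_pred1_eq sum1_card card_ord.
by rewrite inE andbT.
Qed.

End ProductComponents.

(** * Existence of nonzero symmetrized elements over the semisimple ring *)

Section SemisimpleMatrices.
Variables (A : pzRingType) (t : nat) (D : 'I_t -> unitRingType).
Variables (m : 'I_t -> nat) (phi : forall i, {rmorphism A -> 'M[D i]_(m i)}).
Hypotheses (hD : forall i, division_ring (D i)) (hphi : product_iso phi).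
Variable emb : forall i, 'M[D i]_(m i) -> A.
Hypothesis embP : forall i M,
  phi i (emb M) = M /\ forall j, j != i -> phi j (emb M) = 0.
Local Notation E := (matrix_idempotent emb).

Variables (n : nat) (alpha : 'M[A]_n -> 'M[A]_n).
Hypothesis ha : involution alpha.
Variable tau : Cent A -> Cent A.
Hypothesis alpha_tau : forall c, alpha (val c)%:M = (val (tau c))%:M.

Definition mx_idempotent (x : 'I_n * {i & 'I_(m i)}) : 'M[A]_n :=
  entry_mx x.1 x.1 (E x.2).
Local Notation F := mx_idempotent.

Let sp : semiprime 'M[A]_n.
Proof. exact/semiprime_mx/(semiprime_product hD hphi embP). Qed.

Lemma mx_idempotent_division x : division_idempotent (F x).
Proof.
exact/division_idempotent_mx/(matrix_idempotent_division hD hphi embP).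
Qed.

Lemma mx_idempotent_orth x x' : x != x' -> F x * F x' = 0.
Proof.
case: x x' => k y [k' y'] ne; rewrite /F /= mul_entry_mx2.
have [kk|//] := eqVneq k k'; rewrite (matrix_idempotent_orth hphi embP).
  exact: entry_mx0.
by apply: contra ne => /eqP->; rewrite kk.
Qed.

Lemma sum_mx_idempotent : \sum_x F x = 1.
Proof.
rewrite -sum_entry_mx1 -(sum_matrix_idempotent hphi embP).
rewrite -(pair_bigA _ (fun k y => F (k, y))) /=; apply: eq_bigr => k _.
by rewrite entry_mx_sum.
Qed.

Lemma linked_mx_idempotent x x' :
  linked (F x) (F x') <-> tag x.2 = tag x'.2.
Proof.
apply: (iff_trans (linked_mx _ _ _ _)).
exact: (linked_matrix_idempotent hphi embP).
Qed.

Lemma scalar_mx_central (c : Cent A) (X : 'M[A]_n) :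
  (val c)%:M * X = X * (val c)%:M.
Proof.
apply/matrixP => i j; rewrite !mxE (bigD1 i) //= [in RHS](bigD1 j) //=.
rewrite !big1 => [|k ki|k ki].
- by rewrite !mxE !eqxx !mulr1n !addr0 (centralP _ (valP c)).
- by rewrite mxE (negbTE ki) mulr0n mulr0.
- by rewrite mxE eq_sym (negbTE ki) mulr0n mul0r.
Qed.

Lemma mul_scalar_entry_mx (a b : A) (k l : 'I_n) :
  a%:M * entry_mx k l b = entry_mx k l (a * b).
Proof.
rewrite -[LHS]/(a%:M *m _) mul_scalar_mx; apply/matrixP => i j; rewrite !mxE.
by case: ifP; rewrite ?mulr0.
Qed.

Lemma phi_eq0 i x : (forall a : 'I_(m i), x * E (Tagged _ a) = 0) -> phi i x = 0.
Proof.
move=> x0; rewrite -[LHS]mulr1 -sum_entry_mx1 mulr_sumr big1 // => a _.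
have := congr1 (phi i) (x0 a); rewrite rmorph0 rmorphM.
by rewrite [phi i (E _)](phi_emb embP).
Qed.

Lemma has_trace_noncommutative s k y :
  linked (F (k, y)) (alpha (F (k, y))) ->
  ~ commutative (@GRing.mul (D (tag y))) -> has_trace alpha s (F (k, y)).
Proof.
case: y => i a lk nC; apply: contrapT => ntr; apply: nC => b b'.
pose G (d : D i) := entry_mx k k (emb (entry_mx a a d)).
have GM d d' : G d * G d' = G (d * d').
  by rewrite /G mul_entry_mx2 eqxx (emb_mul_emb hphi embP) mul_entry_mx2 eqxx.
have G1 : F (k, existT _ i a) = G 1 by [].
have := trace_free_commutative ha sp (mx_idempotent_division _) lk ntr.
move=> /(_ (G b) (G b')); rewrite G1 !GM !mul1r !mulr1.
move=> /(_ erefl erefl erefl erefl).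
by move=> /entry_mx_inj/(emb_inj embP)/entry_mx_inj.
Qed.

(** By contraposition, [tau c] and [c] are compared in each factor. Self-duality of the class of [y]
    makes [tau c] vanish outside the factor containing [c]; inside it the two agree by
    [trace_free_central]. *)
Lemma has_trace_not_fixed s k y :
  linked (F (k, y)) (alpha (F (k, y))) ->
  ~ fixes_factor phi tau (tag y) -> has_trace alpha s (F (k, y)).
Proof.
case: y => i a lk; set y := existT _ i a in lk *; move=> nfix.
apply: contrapT => ntr; apply: nfix => c [_ c0].
apply/eqP; rewrite -subr_eq0; apply/eqP/val_inj => /=.
apply: (product_iso_inj hphi) => j; rewrite rmorph0.
have [ji|ji] := eqVneq j i; last first.
  rewrite rmorphB /= c0 // subr0; apply: phi_eq0 => b.
  apply: (@entry_mx_inj _ n k k); rewrite entry_mx0 -mul_scalar_entry_mx.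
  apply: (invo_eq0 ha); rewrite (invoM ha) -alpha_tau (invoK ha).
  rewrite -[LHS]mulr1 -sum_mx_idempotent mulr_sumr big1 // => x _.
  apply: contrapT => nz.
  have xi : tag x.2 = i.
    apply: contrapT => /eqP xi; apply: nz.
    rewrite -mulrA /F mul_scalar_entry_mx (emb_mul hphi embP) c0 //.
    by rewrite mul0r (emb0 hphi embP) entry_mx0 mulr0.
  have lg : linked (F (k, existT _ j b)) (alpha (F x)).
    rewrite -[X in linked X _](invoK ha); apply: linked_involution => //.
    by exists (val c)%:M.
  have lyx : linked (F (k, y)) (F x) by apply/linked_mx_idempotent; rewrite xi.
  have dF x' := mx_idempotent_division x'.
  have dA x' := division_idempotent_involution ha sp (dF x').
  have lg' : linked (F (k, existT _ j b)) (alpha (F (k, y))).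
    by apply: (linked_trans sp) lg (linked_involution ha lyx).
  have : linked (F (k, existT _ j b)) (F (k, y)).
    by apply: (linked_trans sp) lg' (linked_sym sp _ _ lk).
  by move/linked_mx_idempotent => /= e; rewrite e eqxx in ji.
rewrite {}ji {j}; apply: phi_eq0 => b.
have := trace_free_central ha sp (mx_idempotent_division _) lk ntr
  (scalar_mx_central c).
rewrite alpha_tau => /(_ (scalar_mx_central _)).
rewrite -rmorphB /= mul_scalar_entry_mx -(entry_mx0 A k k) => /entry_mx_inj d0.
(* Vanishing at one diagonal idempotent spreads to the whole factor through matrix units, since
   [tau c - c] is central. *)
have -> : E (Tagged _ b) =
  emb (entry_mx b a 1) * E y * emb (entry_mx a b 1).
  rewrite /E /= !(emb_mul_emb hphi embP) !mul_entry_mx2 eqxx mul_entry_mx2 eqxx.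
  by rewrite !mulr1.
have dC : val (tau c) - val c \in @central A.
  by rewrite rpredB //; exact: valP.
by rewrite !mulrA (centralP _ dC) -(mulrA _ _ (E y)) d0 mulr0 mul0r.
Qed.

Lemma has_trace_either_sign k k' y y' : tag y = tag y' ->
  (2%:R : D (tag y)) \is a GRing.unit -> linked (F (k, y)) (alpha (F (k, y))) ->
  ~ has_trace alpha false (F (k, y)) -> has_trace alpha true (F (k', y')).
Proof.
case: y => i a; set y := existT _ i a => yy' u2 lk ntr; apply: contrapT => ntr'.
have : F (k, y) + F (k, y) = 0.
  apply: (trace_free_both_signs ha sp _ _ _ lk ntr ntr').
  - exact: mx_idempotent_division.
  - exact: mx_idempotent_division.
  - exact/linked_mx_idempotent.
rewrite -entry_mxD -(embD hphi embP) -(entry_mx0 A k k) => /entry_mx_inj.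
rewrite -(emb0 hphi embP i) => /(emb_inj embP).
rewrite -entry_mxD -(entry_mx0 _ a a) => /entry_mx_inj e.
by move: u2; rewrite -[2%:R]/(1 + 1) e unitr0.
Qed.

End SemisimpleMatrices.

(** * From an invertible form on the corner to an involution of the base ring *)

Section Descent.
Variables (R : pzRingType) (n : nat) (k0 : 'I_n).
Variable alpha : 'M[R]_n -> 'M[R]_n.
Hypothesis ha : involution alpha.
Local Notation ent := (@entry_mx R n k0 k0).
Local Notation e := (ent (1 : R)).

(** While [alpha] moves the corner [e S e] to [alpha(e) S alpha(e)], multiplying by [z] and [k]
    brings it back. In [beta (beta r)] the sign occurs twice, from [k] and from [z], and cancels. *)
Lemma involution_of_hermitian_form (s : bool) (k z : 'M[R]_n) :
  [/\ alpha k = (-1) ^+ s * k, alpha e * k = k /\ k * e = k,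
      e * z = z /\ z * alpha e = z, z * k = e & k * z = alpha e] ->
  exists2 beta : R -> R, involution beta &
    forall r, ent (beta r) = z * alpha (ent r) * k.
Proof.
move=> [ak [ek ke] [ez ze] zk kz].
pose beta r := (z * alpha (ent r) * k) k0 k0.
have ee : e * e = e by rewrite mul_entry_mx2 eqxx mulr1.
have entM x y : ent x * ent y = ent (x * y) by rewrite mul_entry_mx2 eqxx.
have betaE r : ent (beta r) = z * alpha (ent r) * k.
  have -> : z * alpha (ent r) * k = e * (z * alpha (ent r) * k) * e.
    by rewrite !mulrA ez -!mulrA ke.
  by rewrite mul_entry_mx mul1r mulr1.
have inj : injective ent by exact: entry_mx_inj.
(* Uniqueness of inverses: [alpha z] is inverse to [alpha k = s k]. *)
have az : alpha z = (-1) ^+ s * z.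
  have : z * (alpha k * alpha z) = z by rewrite -(invoM ha) zk.
  rewrite ak !mulrA commr_sign -(mulrA _ z k) zk -mulrA.
  have -> : e * alpha z = alpha z by rewrite -[in RHS]ze (invoM ha) (invoK ha).
  by move=> /(congr1 ( *%R ((-1) ^+ s))); rewrite mulrA -expr2 sqrr_sign mul1r.
have betaK : involutive beta.
  move=> r; apply: inj; rewrite !betaE !(invoM ha) (invoK ha) ak az.
  have -> : z * ((-1) ^+ s * k * (ent r * ((-1) ^+ s * z))) * k =
      z * k * ent r * (z * k).
    by case: s {ak az}; rewrite ?mulN1r ?mul1r ?(mulNr, mulrN) ?opprK !mulrA.
  by rewrite zk !entM mul1r mulr1.
exists beta => //; split=> //; split.
- by exists beta.
- move=> x y; apply: inj.
  by rewrite entry_mxB !betaE entry_mxB (invoB ha) mulrBr mulrBl.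
split; first by apply: inj; rewrite betaE ze zk.
move=> x y; suff e1 : beta (x * y) = beta y * beta x by exact: e1.
apply: inj.
rewrite -entM !betaE -entM (invoM ha).
have aex : alpha e * alpha (ent x) = alpha (ent x).
  by rewrite -(invoM ha) entM mulr1.
by rewrite -[in LHS]aex -kz !mulrA.
Qed.

End Descent.

(** * Reduction of matrices modulo the Jacobson radical of the base ring *)

Section ResidueMatrices.
Variables (R : pzRingType) (n : nat).
Local Notation A := (JacQuot R).

Definition residue_mx : {rmorphism 'M[R]_n -> 'M[A]_n} :=
  [the {rmorphism _ -> _} of map_mx (@jac_proj R)].
Local Notation P := residue_mx.

Lemma residue_mxE X i j : P X i j = jac_proj (X i j).
Proof. by rewrite mxE. Qed.

Lemma residue_mx_surj Z : exists X, P X = Z.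
Proof.
exists (\matrix_(i, j) repr (Z i j)); apply/matrixP => i j.
by rewrite residue_mxE mxE [RHS](esym (reprK _)).
Qed.

Lemma residue_mx_ker X : P X = 0 ->
  exists U : 'M[R]_n, U * (1 + X) = 1 /\ (1 + X) * U = 1.
Proof.
move=> PX; apply: jac_mx_inverse => i j; rewrite -(subr0 (X i j)).
by apply/jac_proj_eq; rewrite -residue_mxE PX mxE rmorph0.
Qed.

Lemma residue_entry_mx k l r : P (entry_mx k l r) = entry_mx k l (jac_proj r).
Proof.
by apply/matrixP => i j; rewrite residue_mxE !mxE; case: ifP; rewrite ?rmorph0.
Qed.

Lemma residue_scalar_mx r : P r%:M = (jac_proj r)%:M.
Proof.
by apply/matrixP => i j; rewrite residue_mxE !mxE rmorphMn.
Qed.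

Variables (I : finType) (f : I -> 'M[A]_n).
Hypotheses (sp : semiprime 'M[A]_n) (fd : forall i, division_idempotent (f i))
  (f1 : \sum_i f i = 1).

Lemma residue_jac X : X \in @jac 'M[R]_n -> P X = 0.
Proof.
move=> jX; apply: (division_idempotents_no_radical sp fd f1) => c d.
have [c' <-] := residue_mx_surj c; have [d' <-] := residue_mx_surj d.
have [|U eU] := @jac_left_inverse 'M[R]_n (c' * X * d').
  by apply: jac_mulr; exact: jac_mull.
exists (P U); rewrite -!rmorphM -[X in X + _](rmorph1 P) -rmorphD -rmorphM eU.
exact: rmorph1.
Qed.

(** Quasi-regularity passes through [alpha]: [1 + c alpha(X) d] is the image of
    [1 + alpha(d) X alpha(c)], which is invertible. *)
Lemma residue_involution (alpha : 'M[R]_n -> 'M[R]_n) X :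
  involution alpha -> P X = 0 -> P (alpha X) = 0.
Proof.
move=> ha PX; apply: (division_idempotents_no_radical sp fd f1) => c d.
have [c' <-] := residue_mx_surj c; have [d' <-] := residue_mx_surj d.
have [|U [_ eU]] := @residue_mx_ker (alpha d' * X * alpha c').
  by rewrite !rmorphM PX mulr0 mul0r.
exists (P (alpha U)); rewrite -!rmorphM -[X in X + _](rmorph1 P) -rmorphD -rmorphM.
rewrite -(rmorph1 P); congr (P _).
have := congr1 alpha eU.
by rewrite !(invoM ha) (invoD ha) !(invoM ha) !(invoK ha) (invo1 ha) !mulrA.
Qed.

End ResidueMatrices.

(** * Choice of the sign, lifting of the form and descent to [R] *)

Theorem theorem7p3 (R : pzRingType) (hR : semilocal R) (n : nat) (hn : (0 < n)%N)
  (sigma : {rmorphism Cent R -> Cent R}) (hsigma : bijective sigma)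
  (sbar : {rmorphism Cent (JacQuot R) -> Cent (JacQuot R)})
  (hsbar : bijective sbar)
  (hinv : exists alpha : 'M[R]_n -> 'M[R]_n,
    [/\ involution alpha, mx_has_type alpha sigma
      & mx_has_reduced_type alpha sbar])
  (t : nat) (D : 'I_t -> unitRingType) (hD : forall i, division_ring (D i))
  (m : 'I_t -> nat) (hm : forall i, (0 < m i)%N)
  (phi : forall i, {rmorphism JacQuot R -> 'M[D i]_(m i)})
  (hphi : product_iso phi)
  (l : 'I_t)
  (h1 : forall i : 'I_t, i != l ->
    [\/ ~ commutative (@GRing.mul (D i)), ~~ odd (m i)
      | ~ fixes_factor phi sbar i])
  (h2 : [\/ ~ commutative (@GRing.mul (D l)), ~~ odd (m l),
            ~ fixes_factor phi sbar l | (2%:R : D l) \is a GRing.unit]) :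
  exists beta : R -> R,
    [/\ involution beta, has_type beta sigma & has_reduced_type beta sbar].
Proof.
have [alpha [ha htype hred]] := hinv.
have [emb embP] := product_iso_component hphi.
have sp : semiprime 'M[JacQuot R]_n.
  exact/semiprime_mx/(semiprime_product hD hphi embP).
pose F := @mx_idempotent (JacQuot R) t D m emb n.
have fd x : division_idempotent (F x).
  exact: (mx_idempotent_division hD hphi embP).
have f1 : \sum_x F x = 1 by exact: (sum_mx_idempotent hphi embP).
pose P := residue_mx R n.
have P_surj := @residue_mx_surj R n.
have [abar [hab abarP]] := involution_quotient P_surj ha
  (fun X => @residue_involution R n _ F sp fd f1 alpha X ha).
have abar_sbar c : abar (val c)%:M = (val (sbar c))%:M.
  have [r er] := jac_proj_surj (val c).
  have [r' er'] := jac_proj_surj (val (sbar c)).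
  have /jac_proj_eq/(residue_jac sp fd f1) := hred c r r' er er'.
  rewrite rmorphB -abarP !residue_scalar_mx er er' => /eqP.
  by rewrite subr_eq0 => /eqP.
pose k0 := Ordinal hn.
have tr_noncomm s y := @has_trace_noncommutative _ t D m phi hD hphi emb embP
  n abar hab s k0 y.
have tr_nfix s y := @has_trace_not_fixed _ t D m phi hD hphi emb embP
  n abar hab sbar abar_sbar s k0 y.
(* Outside class [l] either sign works. If the plus sign fails somewhere in class [l], the minus
   sign works throughout it; otherwise plus is taken. *)
have [s hs] : exists s, forall y, linked (F (k0, y)) (abar (F (k0, y))) ->
    odd (m (tag y)) -> has_trace abar s (F (k0, y)).
  have h1' s y : tag y != l -> linked (F (k0, y)) (abar (F (k0, y))) ->
      odd (m (tag y)) -> has_trace abar s (F (k0, y)).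
    move=> yl lk om; case: (h1 _ yl) => [nC|em|nf].
    - exact: tr_noncomm.
    - by rewrite om in em.
    - exact: tr_nfix.
  have [[y [yl lk ntr]]|ex] := pselect (exists y, [/\ tag y = l,
      linked (F (k0, y)) (abar (F (k0, y))) & ~ has_trace abar false (F (k0, y))]).
    exists true => y' lk' om; have [yl'|] := eqVneq (tag y') l; last first.
      by move=> ?; exact: h1'.
    move: h2; rewrite -yl'; case=> [nC|em|nf|u2].
    - exact: tr_noncomm.
    - by rewrite om in em.
    - exact: tr_nfix.
    apply: (@has_trace_either_sign _ _ D m phi hD hphi emb embP n abar hab
      k0 k0 y) => //.
      by rewrite yl.
    by rewrite yl -yl'.
  exists false => y lk om; have [yl|] := eqVneq (tag y) l; last first.
    by move=> ?; exact: h1'.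
  by apply: contrapT => ntr; apply: ex; exists y.
have [|||i|y lk|u [z [eu ez zk kz]]] :=
    @hermitian_form_semisimple _ abar hab sp n k0 _ _ F (@tag _ _) fd _ _ _ _ s.
- exact: (mx_idempotent_orth hphi embP).
- exact: f1.
- exact: (linked_mx_idempotent hphi embP).
- by exists (existT _ i (Ordinal (hm i))).
- by rewrite card_tag; exact: hs.
(* The block sum is the residue of an idempotent of the matrix ring over [R], so the form lifts to
   the corner there. *)
have eE : \sum_y F (k0, y) = P (entry_mx k0 k0 1).
  rewrite residue_entry_mx rmorph1 -(sum_matrix_idempotent hphi embP).
  by rewrite entry_mx_sum.
rewrite eE in eu ez zk kz.
have [||k' [z' hk]] := hermitian_form_lift P_surj (@residue_mx_ker R n) ha
  (abar := abar) (s := s) (e := entry_mx k0 k0 1) (u := u) (z := z) abarP.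
- by rewrite mul_entry_mx2 eqxx mulr1.
- by split.
have [beta hb betaE] := involution_of_hermitian_form ha hk.
case: hk => _ _ [_ ze] zk' _.
(* For central [c] this gives [beta(c) e = z alpha(e) alpha(c I) k = z (sigma(c) I) k = sigma(c) e],
   hence the type. *)
have eC (x : R) : entry_mx k0 k0 x = x%:M * entry_mx k0 k0 1.
  by rewrite mul_scalar_entry_mx mulr1.
exists beta; split=> // [c|c r er].
  apply: (@entry_mx_inj _ _ k0 k0); rewrite betaE eC (invoM ha) mulrA ze htype.
  by rewrite -scalar_mx_central -mulrA zk' -eC.
(* The same computation after reduction, where the class of [r I] is central and [abar] acts on it
   by [sbar]. *)
apply: (@entry_mx_inj _ _ k0 k0); rewrite -!residue_entry_mx betaE eC (invoM ha).
rewrite mulrA ze !rmorphM -[residue_mx _ _ (alpha r%:M)]abarP residue_scalar_mx.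
rewrite er abar_sbar -scalar_mx_central -mulrA -rmorphM zk' residue_entry_mx.
by rewrite mul_scalar_entry_mx rmorph1 mulr1.
Qed.
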